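(* Consider nearest-center assignment in $\mathbb{R}^2$ with the two fixed centers $c_1=(-1,0)$ and $c_2=(1,0)$. For every $\theta>0$ and every $\varepsilon>0$ there exist a configuration $X$ (a finite tuple of points of $\mathbb{R}^2$) with minimum margin $\gamma_{\min}<\theta$ and a perturbation $X'$ (a tuple of the same length) with $\|X-X'\|\le\varepsilon$ such that $A(X')\ne A(X)$.
   Context: $\|\cdot\|$ on $\mathbb{R}^2$ is the Euclidean norm; configurations are ordered tuples $X=(x_1,\dots,x_n)$, $X'=(x_1',\dots,x_n')$ in $(\mathbb{R}^2)^n$ with $n\ge2$, and $\|X-X'\|=\max_{1\le i\le n}\|x_i-x_i'\|$. Nearest-center assignment with a deterministic tie-breaking rule: a fixed function $\ell:\mathbb{R}^2\to\{1,2\}$ with $\|x-c_{\ell(x)}\|\le\|x-c_j\|$ for all $x$ and $j=1,2$; the point $x$ is assigned to $c_{\ell(x)}$. The induced partition $A(X)$ of $[n]=\{1,\dots,n\}$ is the one in which $i,j$ lie in the same block if and only if $\ell(x_i)=\ell(x_j)$. The margin of $x_i$ is $\gamma_i=\min_{j\ne\ell(x_i)}\bigl(\|x_i-c_j\|-\|x_i-c_{\ell(x_i)}\|\bigr)$ and $\gamma_{\min}=\min_{1\le i\le n}\gamma_i$. *)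

(* Defs.v *)
From mathcomp Require Import all_boot all_order all_algebra.
From mathcomp Require Import all_reals.

Set Implicit Arguments.
Unset Strict Implicit.
Unset Printing Implicit Defensive.

Import Order.TTheory GRing.Theory Num.Theory.
Local Open Scope ring_scope.

Section NearestCenter.
Context {R : realType}.

(* The norm [`|x|] that MathComp-Analysis puts on matrices is the sup norm,
   hence this separate Euclidean norm. *)
Definition enorm d (x : 'rV[R]_d) : R := Num.sqrt (\sum_(i < d) x 0 i ^+ 2).

Definition config d n := 'I_n -> 'rV[R]_d.

(* The default value 0 is harmless, as all the terms are nonnegative. *)
Definition config_dist d n (X X' : config d n) : R :=
  \big[Num.max/0]_(i < n) enorm (X i - X' i).

(* A nearest-center assignment with a deterministic tie-breaking rule: a
   function of the point alone that returns the index of some nearest center. *)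
Definition nearest_assignment d k (c : 'I_k -> 'rV[R]_d)
    (l : 'rV[R]_d -> 'I_k) : Prop :=
  forall x j, enorm (x - c (l x)) <= enorm (x - c j).

Definition induced_partition d k n (l : 'rV[R]_d -> 'I_k) (X : config d n) :
    {set {set 'I_n}} :=
  preim_partition (fun i => l (X i)) [set: 'I_n].

(* Minima of finite families are computed in [\bar R] because min has no
   neutral element in [R]; the value +oo only arises for an empty family. *)
Definition margin d k (c : 'I_k -> 'rV[R]_d) (l : 'rV[R]_d -> 'I_k)
    (x : 'rV[R]_d) : \bar R :=
  \big[mine/+oo%E]_(j < k | j != l x)
    (enorm (x - c j) - enorm (x - c (l x)))%:E.

Definition min_margin d k n (c : 'I_k -> 'rV[R]_d) (l : 'rV[R]_d -> 'I_k)
    (X : config d n) : \bar R :=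
  \big[mine/+oo%E]_(i < n) margin c l (X i).

Definition point (a b : R) : 'rV[R]_2 := \row_(i < 2) [:: a; b]`_i.

(* The index 0 stands for the label 1, and the index 1 for the label 2. *)
Definition two_centers (j : 'I_2) : 'rV[R]_2 :=
  if j == 0 then point (- 1) 0 else point 1 0.

End NearestCenter.

Arguments config R d n : clear implicits.
Arguments two_centers R j : clear implicits.

(* Main.v *)
Require Import Defs.
From mathcomp Require Import all_boot all_order all_algebra.
From mathcomp Require Import all_reals.
From mathcomp Require Import lra.

Import Order.TTheory GRing.Theory Num.Theory.
Local Open Scope ring_scope.

(** Every point with nonzero first coordinate [a] on the axis through the two
    centers has its label dictated by the sign of [a], whatever the
    tie-breaking rule, and its margin [ `|a + 1| - `|a - 1| ] (for [0 < a]) is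
    at most [2 * a] by the triangle inequality.  So with
    [t = min theta epsilon / 4] the points [(t, 0)] and [(- t, 0)] have margin
    below [theta], lie at distance [2 * t <= epsilon], and have different
    labels ([label_right], [label_left]).  Put both points of [X] at [(t, 0)],
    and move the second one to [(- t, 0)]: the two indices share a block before
    the move and are separated after it, which is read off the partitions with
    [mem_pblock_induced_partition]. *)

Section Configurations.
Variables (R : realType) (d k n : nat).
Implicit Types (c : 'I_k -> 'rV[R]_d) (l : 'rV[R]_d -> 'I_k).
Implicit Type X : config R d n.

(** Two partitions of the indices are told apart by whether they put a given
    pair of indices in one block, so this is how the change of partition is
    detected. *)
Lemma mem_pblock_induced_partition l X (i j : 'I_n) :
  (j \in pblock (induced_partition l X) i) = (l (X i) == l (X j)).
Proof.
rewrite /induced_partition /preim_partition pblock_equivalence_partition //.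
by move=> x y z _ _ _; split=> // /eqP ->.
Qed.

Lemma min_margin_le c l X (i : 'I_n) (j : 'I_k) : j != l (X i) ->
  (min_margin c l X <= (enorm (X i - c j) - enorm (X i - c (l (X i))))%:E)%E.
Proof.
move=> hj; apply: (@le_trans _ _ (margin c l (X i))).
  exact: bigmin_le_cond.
exact: bigmin_le_cond.
Qed.

End Configurations.

Arguments min_margin_le {R d k n c l X i j}.

Section TwoCenters.
Variable R : realType.
Implicit Types a b : R.

Lemma enorm_axis a : enorm (point a 0) = `|a|.
Proof.
by rewrite /enorm !big_ord_recl big_ord0 !mxE /= expr0n !addr0 sqrtr_sqr.
Qed.

Lemma sub_axis a b : point a 0 - point b 0 = point (a - b) 0.
Proof.
by apply/rowP => -[[|[|//]] ?]; rewrite !mxE //= subr0.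
Qed.

Lemma dist_left_center a :
  enorm (point a 0 - two_centers R ord0) = `|a + 1|.
Proof. by rewrite /two_centers eqxx sub_axis enorm_axis opprK. Qed.

Lemma dist_right_center a :
  enorm (point a 0 - two_centers R ord_max) = `|a - 1|.
Proof. by rewrite /two_centers /= sub_axis enorm_axis. Qed.

(** Comparing squares avoids splitting on the position of [a] with respect to
    the centers: the squares differ by [4 * a]. *)
Lemma axis_left_closer a : (`|a + 1| <= `|a - 1|) = (a <= 0).
Proof.
rewrite -ler_sqr ?nnegrE ?normr_ge0 // !real_normK ?num_real //.
rewrite sqrrD sqrrB !mulr1 expr1n lerD2r lerD2l -subr_le0 opprK -mulrnDr.
by rewrite pmulrn_lle0.
Qed.

Lemma axis_right_closer a : (`|a - 1| <= `|a + 1|) = (0 <= a).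
Proof.
by rewrite -oppr_le0 -axis_left_closer [- a + 1]addrC distrC -opprD normrN.
Qed.

Variable l : 'rV[R]_2 -> 'I_2.
Hypothesis hl : nearest_assignment (two_centers R) l.

Lemma label_cases (x : 'rV[R]_2) : l x = ord0 \/ l x = ord_max.
Proof.
by case: (l x) => -[|[|//]] hi; [left | right]; apply/val_inj.
Qed.

Lemma label_right a : 0 < a -> l (point a 0) = ord_max.
Proof.
move=> a0; case: (label_cases (point a 0)) => // e.
have := hl (point a 0) ord_max.
by rewrite e dist_left_center dist_right_center axis_left_closer leNgt a0.
Qed.

Lemma label_left a : a < 0 -> l (point a 0) = ord0.
Proof.
move=> a0; case: (label_cases (point a 0)) => // e.
have := hl (point a 0) ord0.
by rewrite e dist_left_center dist_right_center axis_right_closer leNgt a0.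
Qed.

End TwoCenters.

Theorem proposition6p6 (R : realType) (l : 'rV[R]_2 -> 'I_2)
    (hl : nearest_assignment (two_centers R) l)
    (theta epsilon : R) (htheta : 0 < theta) (hepsilon : 0 < epsilon) :
  exists (n : nat) (X X' : config R 2 n),
    [/\ (2 <= n)%N,
        (min_margin (two_centers R) l X < theta%:E)%E,
        config_dist X X' <= epsilon &
        induced_partition l X' <> induced_partition l X].
Proof.
pose m := Num.min theta epsilon.
have m0 : 0 < m by rewrite lt_min htheta.
pose t : R := m / 4%:R.
have t0 : 0 < t by rewrite divr_gt0.
have t2m : t *+ 2 < m by rewrite /t mulr2n; lra.
have nt0 : - t < 0 by rewrite oppr_lt0.
pose X : config R 2 2 := fun=> point t 0.
pose X' : config R 2 2 :=
    fun i => if i == ord0 then point t 0 else point (- t) 0.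
exists 2%N, X, X'; split=> //.
- have hj : ord0 != l (X ord0) by rewrite /X label_right.
  apply: le_lt_trans (min_margin_le hj) _.
  rewrite /X label_right // dist_left_center dist_right_center lte_fin.
  (* Written as [1 - t], the second distance differs from [t + 1] by [2 * t]. *)
  rewrite [`|t - 1|]distrC; apply: le_lt_trans (lerB_dist _ _) _.
  rewrite opprB addrACA subrr addr0 -mulr2n gtr0_norm ?pmulrn_lgt0 //.
  by apply: lt_le_trans t2m _; rewrite ge_min lexx.
- apply: bigmax_le => [|i _]; first exact: ltW.
  rewrite /X /X'; case: ifP => _; rewrite sub_axis enorm_axis ?subrr ?normr0.
    exact: ltW.
  rewrite opprK -mulr2n gtr0_norm ?pmulrn_lgt0 //.
  by apply: le_trans (ltW t2m) _; rewrite ge_min lexx orbT.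
- move=> /(congr1 (fun P => (ord_max : 'I_2) \in pblock P ord0)).
  by rewrite !mem_pblock_induced_partition eqxx /X' /= label_right // label_left.
Qed.
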